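(* Consider a bipartite graph with vertex set the disjoint union $A \cup B$ and edges between $A$ and $B$, and let $X$ be the simplicial complex on $A \cup B$ whose Stanley-Reisner ideal is the edge ideal of this graph. Let $Y$ be the simplicial complex on $B$ consisting of the subsets $\mathbf{b}$ of $B$ such that $\mathbf{b} \cup \{a\}$ is a face of $X$ for some $a \in A$ (that is, there is no edge between $a$ and any element of $\mathbf{b}$). Then $X$ is homotopy equivalent to the suspension of $Y$.
   Context: The edge ideal of a graph is the ideal generated by the monomials $x_u x_v$ for $\{u,v\}$ an edge; the faces of $X$ are the subsets of $A \cup B$ containing no edge of the graph. The suspension of a simplicial complex $Y$ is the join of $Y$ with the complex consisting of two disjoint points. Homotopy equivalence of simplicial complexes means homotopy equivalence of geometric realizations.
   Formalization: Both A and B are assumed nonempty; without this the claim fails, e.g. for A = {a} and B empty, X is a point while Y = {∅} has suspension two disjoint points. *)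

(* Defs.v *)
From HB Require Import structures.
From mathcomp Require Import all_boot all_order all_algebra.
From mathcomp Require mpoly.
From mathcomp Require Import all_classical all_reals all_analysis.
(* The notations of mpoly clash with those of mathcomp-analysis. *)
Import (canonicals) mpoly.

Set Implicit Arguments.
Unset Strict Implicit.
Unset Printing Implicit Defensive.

Import Order.TTheory GRing.Theory Num.Theory.
Import numFieldNormedType.Exports.

Local Open Scope classical_set_scope.
Local Open Scope ring_scope.

Section Complexes.

(* The empty collection of faces is allowed, and elements of V need not be
   vertices. *)
Record complex (V : finType) := Complex {
  faces :> {set {set V}};
  faces_closed : forall s t : {set V}, s \in faces -> t \subset s -> t \in faces
}.

(* The vertex set is the disjoint union V + W; a subset of it is s * t with
   s the part in V and t the part in W. *)
Definition join_faces (V W : finType) (K : complex V) (L : complex W) :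
    {set {set V + W}} :=
  finset (fun s : {set V + W} => (inl @^-1: s \in K) && (inr @^-1: s \in L)).

Lemma join_faces_closed (V W : finType) (K : complex V) (L : complex W)
    (s t : {set V + W}) :
  s \in join_faces K L -> t \subset s -> t \in join_faces K L.
Proof.
rewrite !inE => /andP[sK sL] ts.
by rewrite (faces_closed sK) ?(faces_closed sL) // preimsetS.
Qed.

Definition join (V W : finType) (K : complex V) (L : complex W) :
    complex (V + W)%type :=
  Complex (@join_faces_closed V W K L).

Definition two_points_faces : {set {set bool}} :=
  finset (fun s : {set bool} => #|s| <= 1)%N.

Lemma two_points_faces_closed (s t : {set bool}) :
  s \in two_points_faces -> t \subset s -> t \in two_points_faces.
Proof. by rewrite !inE => s1 /subset_leq_card/leq_trans; exact. Qed.

Definition two_points : complex bool := Complex two_points_faces_closed.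

Definition suspension (V : finType) (K : complex V) : complex (V + bool)%type :=
  join K two_points.

End Complexes.

Section StanleyReisner.
Variables (k : fieldType) (V : finType).

(* The polynomial ring with one variable for each v in V. *)
Definition pring : comNzRingType := mpoly.mpoly #|V| k.

Definition var (v : V) : pring := mpoly.mpolyX k (mpoly.mnm1 (enum_rank v)).

Definition ideal_gen (S : set pring) : set pring :=
  [set p | exists (m : nat) (c g : 'I_m -> pring),
     (forall i, S (g i)) /\ p = \sum_(i < m) c i * g i].

Definition stanley_reisner_ideal (K : complex V) : set pring :=
  ideal_gen [set p | exists s : {set V},
    s \notin K /\ p = \prod_(v in s) var v].

Definition edge_ideal (G : rel V) : set pring :=
  ideal_gen [set p | exists u v : V, G u v /\ p = var u * var v].

End StanleyReisner.

Arguments stanley_reisner_ideal k {V} K.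
Arguments edge_ideal k {V} G.

Section Bipartite.
Variables A B : finType.

Definition bipartite (G : rel (A + B)%type) : Prop :=
  [/\ symmetric G,
      forall a a' : A, ~~ G (inl a) (inl a') &
      forall b b' : B, ~~ G (inr b) (inr b')].

Definition link_union_faces (X : complex (A + B)%type) : {set {set B}} :=
  finset (fun b : {set B} =>
    [exists a : A, (inl a |: inr @: b)%SET \in X]).

Lemma link_union_faces_closed (X : complex (A + B)%type) (s t : {set B}) :
  s \in link_union_faces X -> t \subset s -> t \in link_union_faces X.
Proof.
rewrite !inE => /existsP[a aX] ts; apply/existsP; exists a.
by apply: faces_closed aX _; rewrite finset.setUS // imsetS.
Qed.

(* The union over a in A of the traces on B of the links of a in X. *)
Definition link_union (X : complex (A + B)%type) : complex B :=
  Complex (@link_union_faces_closed X).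

End Bipartite.

Section Topology.
Variable R : realType.

(* Barycentric coordinates, as a subspace of the finite product R^V. *)
Definition realization_set (V : finType) (K : complex V) : set {ptws V -> R} :=
  [set x | [/\ forall v, 0 <= x v, \sum_v x v = 1
             & finset (fun v => x v != 0) \in K]].

Definition realization (V : finType) (K : complex V) : topologicalType :=
  set_type (realization_set K).

Definition homotopic (X Y : topologicalType) (f g : X -> Y) : Prop :=
  exists H : X * R -> Y,
    [/\ {within [set: X] `*` `[0, 1], continuous H},
        forall x, H (x, 0) = f x & forall x, H (x, 1) = g x].

Definition homotopy_equivalent (X Y : topologicalType) : Prop :=
  exists (f : X -> Y) (g : Y -> X),
    [/\ continuous f, continuous g,
        homotopic (g \o f) idfun & homotopic (f \o g) idfun].

End Topology.

(* Main.v *)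
Require Import Defs.
From mathcomp Require Import all_boot all_order all_algebra.
From mathcomp Require mpoly.
From mathcomp Require Import all_classical all_reals all_analysis.
From mathcomp Require Import lra.
Import (canonicals) mpoly.

(** A set of vertices is a face of X exactly when it contains no edge
    (face_edge_ideal), that is, when no a and b in it are adjacent, the graph
    being bipartite.  So X lies in the join of the simplex on A and the simplex
    on B: it is a union of segments with one end in each.  Over the middle of
    the segments one finds the pairs (p, q) with independent supports, and the
    projection (p, q) |-> q has image Y and simplices as fibers.  Thus X is the
    double mapping cylinder of two maps, from a space equivalent to Y to two
    contractible spaces: a suspension of Y.

    Explicitly, suspend collapses the two simplices to the poles and forgets
    p in between.  In the other direction a point q of Y must be given a
    compatible p, which cannot be done continuously without moving q; desuspend
    therefore cuts q off below a threshold, and spreads p over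
    the vertices a whose neighbours have total weight below that threshold.

    Neither composite is contiguous to the identity, but each is so in two
    steps (homotopic_desuspend_suspend, homotopic_suspend_desuspend): there is
    an intermediate map that lies, at every point, in a common simplex with the
    composite and in a common simplex with the identity.  Then the two
    straight-line homotopies can be concatenated (homotopic_through).  All maps
    are given by nonnegative weights that are normalized afterwards, so that
    only supports have to be followed. *)

Set Implicit Arguments.
Unset Strict Implicit.
Unset Printing Implicit Defensive.

Import Order.TTheory GRing.Theory Num.Theory.
Import numFieldNormedType.Exports.

Local Open Scope classical_set_scope.
Local Open Scope ring_scope.

(** * Faces of the complex defined by an edge ideal *)

Section FacesOfEdgeIdeal.
Variables (k : fieldType) (V : finType).

(** The value at the 0/1 point of s of a monomial is 1 or 0 according to
    whether its variables all lie in s.  Hence these values detect which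
    square-free monomials belong to an ideal generated by such monomials. *)
Definition eval_indicator (s : {set V}) (p : pring k V) : k :=
  mpoly.meval (fun i => (enum_val i \in s)%:R) p.

Lemma eval_indicator_var (s : {set V}) (v : V) :
  eval_indicator s (var k v) = (v \in s)%:R.
Proof. by rewrite /eval_indicator /var mpoly.mevalXU enum_rankK. Qed.

Lemma eval_indicator_monomial (s t : {set V}) :
  eval_indicator s (\prod_(v in t) var k v) = (t \subset s)%:R.
Proof.
rewrite /eval_indicator rmorph_prod /=.
under eq_bigr do rewrite -/(eval_indicator _ _) eval_indicator_var.
have [/fintype.subsetP ts|/subsetPn[v vt vs]] := boolP (t \subset s).
  by rewrite big1 // => v /ts ->.
by rewrite (bigD1 v) //= (negbTE vs) mul0r.
Qed.

Lemma eval_indicator_edge (s : {set V}) (u v : V) :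
  eval_indicator s (var k u * var k v) = ((u \in s) && (v \in s))%:R.
Proof.
rewrite /eval_indicator mpoly.mevalM -!/(eval_indicator _ _).
by rewrite !eval_indicator_var; case: (u \in s); rewrite ?mul1r ?mul0r.
Qed.

Lemma eval_indicator_ideal (s : {set V}) (S : set (pring k V)) p :
  ideal_gen S p -> eval_indicator s p != 0 ->
  exists2 q, S q & eval_indicator s q != 0.
Proof.
move=> [m [c [g [Sg ->]]]] p_neq0; apply: contrapT => S0.
case/negP: p_neq0; apply/eqP.
rewrite /eval_indicator rmorph_sum big1 //= => i _.
rewrite mpoly.mevalM -!/(eval_indicator _ _).
have [->|gi_neq0] := eqVneq (eval_indicator s (g i)) 0; first exact: mulr0.
by case: S0; exists (g i).
Qed.

Lemma mem_ideal_gen (S : set (pring k V)) p : S p -> ideal_gen S p.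
Proof.
move=> Sp; exists 1%N, (fun=> 1), (fun=> p); split=> //.
by rewrite big_ord1 mul1r.
Qed.

(** If an edge uv lies in s, its monomial is a combination of monomials of
    non-faces; evaluating at s, one of these non-faces is a subset of s.
    If s is not a face, its monomial is a combination of edge monomials;
    evaluating at s, one of these edges lies in s. *)
Lemma face_edge_ideal (G : rel V) (X : complex V) (s : {set V}) :
  stanley_reisner_ideal k X = edge_ideal k G ->
  s \in X <-> {in s &, forall u v, ~~ G u v}.
Proof.
move=> XG; split=> [sX u v us vs|indep].
  apply/negP => Guv.
  have : stanley_reisner_ideal k X (var k u * var k v).
    by rewrite XG; apply: mem_ideal_gen; exists u, v.
  move=> /(eval_indicator_ideal (s := s)) [].
    by rewrite eval_indicator_edge us vs oner_eq0.
  move=> _ [t [tX ->]]; rewrite eval_indicator_monomial.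
  case: (boolP (t \subset s)) => [ts _|_]; last by rewrite eqxx.
  by rewrite (faces_closed sX ts) in tX.
apply/negPn/negP => sX.
have : edge_ideal k G (\prod_(v in s) var k v).
  by rewrite -XG; apply: mem_ideal_gen; exists s.
move=> /(eval_indicator_ideal (s := s)) [].
  by rewrite eval_indicator_monomial subxx oner_eq0.
move=> _ [u [v [Guv ->]]]; rewrite eval_indicator_edge.
case: andP => [[us vs] _|_]; last by rewrite eqxx.
by have := indep u v us vs; rewrite Guv.
Qed.

End FacesOfEdgeIdeal.

(** * Continuity of real-valued formulas *)

Section PositivePart.
Variable R : realType.

Definition pos (x : R) : R := Num.max x 0.

Lemma pos_ge0 x : 0 <= pos x.
Proof. by rewrite le_max lexx orbT. Qed.

Lemma pos_gt0 x : (0 < pos x) = (0 < x).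
Proof. by rewrite lt_max ltxx orbF. Qed.

Lemma pos_eq0 x : x <= 0 -> pos x = 0.
Proof. exact: max_r. Qed.

Lemma pos_eq x : 0 <= x -> pos x = x.
Proof. exact: max_l. Qed.

Lemma continuous_pos (T : topologicalType) (f : T -> R) :
  continuous f -> continuous (fun t => pos (f t)).
Proof. by move=> cf t; apply: continuous_max; [exact: cf|exact: cst_continuous]. Qed.

Section Arithmetic.
Variables (T : topologicalType) (f g : T -> R).
Hypotheses (cf : continuous f) (cg : continuous g).

Lemma continuous_addr : continuous (fun t => f t + g t).
Proof. by move=> t; apply: cvgD; [exact: cf|exact: cg]. Qed.

Lemma continuous_subr : continuous (fun t => f t - g t).
Proof. by move=> t; apply: cvgB; [exact: cf|exact: cg]. Qed.

Lemma continuous_mulr : continuous (fun t => f t * g t).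
Proof. by move=> t; apply: cvgM; [exact: cf|exact: cg]. Qed.

Lemma continuous_sub_cst c : continuous (fun t => f t - c).
Proof. by move=> t; apply: cvgB; [exact: cf|exact: cvg_cst]. Qed.

Lemma continuous_cst_sub c : continuous (fun t => c - f t).
Proof. by move=> t; apply: cvgB; [exact: cvg_cst|exact: cf]. Qed.

Lemma continuous_cst_mul c : continuous (fun t => c * f t).
Proof. by move=> t; apply: cvgM; [exact: cvg_cst|exact: cf]. Qed.

End Arithmetic.

Lemma continuous_sum (T : topologicalType) (I : finType) (P : pred I)
    (F : I -> T -> R) :
  (forall i, continuous (F i)) -> continuous (fun t => \sum_(i | P i) F i t).
Proof. by move=> cF; apply: (continuous_big add_continuous) => i _; exact: cF. Qed.

Lemma continuous_ptws (T : topologicalType) (I : finType) (F : T -> {ptws I -> R}) :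
  (forall i, continuous (fun t => F t i)) -> continuous F.
Proof.
move=> cF t; apply/cvg_sup => i; move: t.
apply: (@continuous_comp_initial _ _ _ (fun g : I -> R => g i) F).
exact: cF.
Qed.

End PositivePart.

(** * Maps into a geometric realization, up to normalization *)

Section Normalization.
Variable R : realType.

Definition supp (V : finType) (w : V -> R) : {set V} := finset (fun v => 0 < w v).

(** The open cone over the realization: dividing by the sum of the values is a
    retraction of it onto the realization, and does not change supports. *)
Definition cone (V : finType) (K : complex V) : set (V -> R) :=
  [set w | [/\ forall v, 0 <= w v, exists v, 0 < w v & supp w \in K]].

Definition normalize (V : finType) (w : V -> R) (v : V) : R :=
  w v / \sum_u w u.

Definition coord (V : finType) (K : complex V) (x : realization R K) : V -> R :=
  set_val x.

Section OneComplex.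
Variables (V : finType) (K : complex V).
Implicit Types (w : V -> R) (x : realization R K).

Lemma cone_sum_gt0 w : cone K w -> 0 < \sum_v w v.
Proof.
case=> w0 [v wv] _; rewrite (bigD1 v) //=.
by apply: ltr_pwDl => //; exact: sumr_ge0.
Qed.

Lemma normalize_gt0 w v : cone K w -> (0 < normalize w v) = (0 < w v).
Proof. by move=> /cone_sum_gt0 w0; rewrite /normalize pmulr_lgt0 // invr_gt0. Qed.

Lemma realization_normalize w : cone K w -> realization_set K (normalize w).
Proof.
move=> Kw; have w_gt0 := cone_sum_gt0 Kw; have [w0 _ wK] := Kw; split.
- by move=> v; rewrite divr_ge0 // ltW.
- by rewrite -mulr_suml divff // gt_eqF.
- rewrite [X in X \in _](_ : _ = supp w) //; apply/setP => v.
  by rewrite !inE -(normalize_gt0 v Kw) lt0r divr_ge0 ?andbT // ltW.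
Qed.

Lemma coord_ge0 x v : 0 <= coord x v.
Proof. by have [/(_ v)] := set_valP x. Qed.

Lemma coord_eq0 x v : ~ 0 < coord x v -> coord x v = 0.
Proof. by move/negP; rewrite lt0r coord_ge0 andbT negbK => /eqP. Qed.

Lemma coord_sum x : \sum_v coord x v = 1.
Proof. by have [_] := set_valP x. Qed.

Lemma coord_supp x : supp (coord x) \in K.
Proof.
have [x0 _] := set_valP x; rewrite [X in X \in K](_ : _ = supp (coord x)) //.
by apply/setP => v; rewrite !inE lt0r x0 andbT.
Qed.

Lemma coord_exists x : exists v, 0 < coord x v.
Proof.
apply/not_existsP => x0; have := coord_sum x; rewrite big1 => [/esym/eqP|v _].
  by rewrite oner_eq0.
exact: coord_eq0.
Qed.

Lemma coord_inj x y : coord x = coord y -> x = y.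
Proof. exact: val_inj. Qed.

Lemma continuous_coord v : continuous (fun x => coord x v).
Proof.
move=> x; apply: (@continuous_comp _ _ _
  (set_val : realization R K -> {ptws V -> R}) (proj v) x).
  exact: initial_continuous.
exact: proj_continuous.
Qed.

Lemma continuous_coord_comp (T : topologicalType) (f : T -> realization R K) v :
  continuous f -> continuous (fun t => coord (f t) v).
Proof.
move=> cf t; apply: (@continuous_comp _ _ _ f (fun x => coord x v)).
  exact: cf.
exact: continuous_coord.
Qed.

Section Projection.
Variables (T : topologicalType) (F : T -> V -> R).
Hypothesis FK : forall t, cone K (F t).

Definition project (t : T) : realization R K :=
  exist (fun w => w \in realization_set K) (normalize (F t))
    (mem_set (realization_normalize (FK t))).

Lemma coord_project t : coord (project t) = normalize (F t).
Proof. by []. Qed.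

Lemma coord_project_gt0 t v : (0 < coord (project t) v) = (0 < F t v).
Proof. by rewrite coord_project normalize_gt0. Qed.

Lemma continuous_project :
  (forall v, continuous (fun t => F t v)) -> continuous project.
Proof.
move=> cF; apply: continuous_comp_initial; apply: continuous_ptws => v t.
apply: cvgM; first exact: cF.
apply: cvgV; first by rewrite gt_eqF // cone_sum_gt0.
exact: continuous_sum.
Qed.

End Projection.
End OneComplex.

(** If f and m lie in a common simplex at each point, the segment joining them
    stays in the realization, and similarly for m and g; the homotopy runs
    through the two segments.  The values of m need not sum to 1, because the
    homotopy is normalized at each time. *)
Lemma homotopic_through (T : topologicalType) (V : finType) (K : complex V)
    (f g : T -> realization R K) (m : T -> V -> R) :
    continuous f -> continuous g -> (forall v, continuous (fun t => m t v)) ->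
    (forall t v, 0 <= m t v) -> (forall t, exists v, 0 < m t v) ->
    (forall t, (supp (coord (f t)) :|: supp (m t))%SET \in K) ->
    (forall t, (supp (m t) :|: supp (coord (g t)))%SET \in K) ->
  homotopic R f g.
Proof.
move=> cf cg cm m_ge0 m_gt0 fmK mgK.
(* The three coefficients are supported on s <= 1/2, 0 < s < 1 and s >= 1/2.
   At every real s at least one of them is positive, hence continuity holds on
   all of T * R. *)
pose F (p : T * R) v := pos (1 - 2 * p.2) * coord (f p.1) v
  + pos (1 - `|2 * p.2 - 1|) * m p.1 v + pos (2 * p.2 - 1) * coord (g p.1) v.
have FK p : cone K (F p).
  have f0 v : 0 <= pos (1 - 2 * p.2) * coord (f p.1) v.
    by rewrite mulr_ge0 ?pos_ge0 ?coord_ge0.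
  have m0 v : 0 <= pos (1 - `|2 * p.2 - 1|) * m p.1 v.
    by rewrite mulr_ge0 ?pos_ge0.
  have g0 v : 0 <= pos (2 * p.2 - 1) * coord (g p.1) v.
    by rewrite mulr_ge0 ?pos_ge0 ?coord_ge0.
  split.
  - by move=> v; rewrite /F !addr_ge0.
  - have [p_lt|p_gt|p_eq] := ltgtP (2 * p.2) 1.
    + have [v fv] := coord_exists (f p.1); exists v.
      by rewrite /F -addrA ltr_pwDl ?addr_ge0 // mulr_gt0 // pos_gt0 subr_gt0.
    + have [v gv] := coord_exists (g p.1); exists v.
      by rewrite /F ltr_wpDl ?addr_ge0 // mulr_gt0 // pos_gt0 subr_gt0.
    + have [v mv] := m_gt0 p.1; exists v.
      rewrite /F p_eq subrr !(pos_eq0 (lexx _)) normr0 subr0 mul0r add0r.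
      by rewrite mul0r addr0 mulr_gt0 // pos_gt0.
  - have [p_le|/ltW p_ge] := leP (2 * p.2) 1.
      apply: faces_closed (fmK p.1) _; apply/fintype.subsetP => v; rewrite !inE.
      rewrite /F [pos (2 * _ - 1)]pos_eq0 ?subr_le0 // mul0r addr0.
      apply: contraLR; rewrite negb_or -!leNgt => /andP[fv mv].
      by rewrite -[0]addr0 lerD // mulr_ge0_le0 ?pos_ge0.
    apply: faces_closed (mgK p.1) _; apply/fintype.subsetP => v; rewrite !inE.
    rewrite /F [pos (1 - 2 * _)]pos_eq0 ?subr_le0 // mul0r add0r.
    apply: contraLR; rewrite negb_or -!leNgt => /andP[mv gv].
    by rewrite -[0]addr0 lerD // mulr_ge0_le0 ?pos_ge0.
exists (project FK); split.
- apply/continuous_subspaceT/continuous_project => v.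
  have cfst (h : T -> R) : continuous h -> continuous (fun p : T * R => h p.1).
    move=> ch p; apply: (@continuous_comp _ _ _ fst h); first exact: cvg_fst.
    exact: ch.
  have c2 : continuous (fun p : T * R => 2 * p.2).
    by apply: continuous_cst_mul => p; exact: cvg_snd.
  have c2B1 := continuous_sub_cst (c := 1) c2.
  have cmid : continuous (fun p : T * R => `|2 * p.2 - 1|).
    by move=> p; apply: cvg_norm; exact: c2B1.
  have ccoord (h : T -> realization R K) : continuous h ->
      continuous (fun p : T * R => coord (h p.1) v).
    move=> ch; apply: (cfst (fun t => coord (h t) v)).
    exact: continuous_coord_comp.
  apply: continuous_addr; first apply: continuous_addr; apply: continuous_mulr.
  + exact/continuous_pos/continuous_cst_sub.
  + exact: ccoord.
  + exact/continuous_pos/continuous_cst_sub.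
  + exact: (cfst (fun t => m t v)).
  + exact: continuous_pos.
  + exact: ccoord.
- move=> t; apply: coord_inj; rewrite coord_project.
  have Fe : F (t, 0) = coord (f t).
    apply/funext => v; rewrite /F /= mulr0 subr0 sub0r normrN1 subrr.
    rewrite (pos_eq ler01) (pos_eq0 (lexx _)) pos_eq0 ?lerN10 //.
    by rewrite mul1r !mul0r !addr0.
  by rewrite Fe; apply/funext => v; rewrite /normalize coord_sum divr1.
- move=> t; apply: coord_inj; rewrite coord_project.
  have Fe : F (t, 1) = coord (g t).
    have e : 2 - 1 = 1 :> R by lra.
    apply/funext => v; rewrite /F /= mulr1 e normr1 subrr.
    rewrite (pos_eq ler01) (pos_eq0 (lexx _)) pos_eq0; last by lra.
    by rewrite mul1r !mul0r !add0r.
  by rewrite Fe; apply/funext => v; rewrite /normalize coord_sum divr1.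
Qed.

End Normalization.

(** * Independence complexes of bipartite graphs as suspensions *)

Section SuspensionOfLinkUnion.
Variables (R : realType) (A B : finType) (E : A -> B -> bool).
Variable X : complex (A + B)%type.
Hypotheses (A_neq0 : (0 < #|A|)%N) (B_neq0 : (0 < #|B|)%N).
Hypothesis X_faces : forall s : {set A + B},
  s \in X <-> forall a b, inl a \in s -> inr b \in s -> ~~ E a b.

Local Notation SY := (suspension (link_union X)).
Local Notation bottom := (inr false : B + bool).
Local Notation top := (inr true : B + bool).

Lemma suspension_face (s : {set B + bool}) :
  s \in SY <-> (exists a, forall b, inl b \in s -> ~~ E a b) /\
               ~ (top \in s /\ bottom \in s).
Proof.
have linkP a : (inl a |: inr @: (inl @^-1: s))%SET \in X <->
    forall b, inl b \in s -> ~~ E a b.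
  rewrite X_faces; split=> [nE b sb|nE a' b].
    by apply: nE; rewrite !inE ?eqxx //= mem_imset ?inE //; exact: inr_inj.
  rewrite !inE => /orP[/eqP[->]|/imsetP[? _ //]] /=.
  by case/imsetP=> b' + [->]; rewrite inE; exact: nE.
have polesP : (#|(inr @^-1: s)%SET : {set bool}| <= 1)%N <->
    ~ (top \in s /\ bottom \in s).
  split=> [/card_le1_eqP le1 [st sb]|sN].
    by have := le1 true false; rewrite !inE => /(_ st sb).
  apply/card_le1_eqP => -[] []; rewrite !inE // => s1 s2; exfalso; exact: sN.
rewrite !inE; split=> [/andP[/existsP[a /linkP sa] /polesP sN]|[[a /linkP sa] /polesP sN]].
  by split=> //; exists a.
by apply/andP; split=> //; apply/existsP; exists a.
Qed.

Definition weightB (w : A + B -> R) : R := \sum_b w (inr b).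

(** A point of X is a pair of a point of the simplex on A and a point of the
    simplex on B, joined with weight t = weightB on the second.  The slices
    t = 0 and t = 1 are whole simplices, and are sent to the poles; for
    t in between, some a in A carries weight, so that the B-coordinates are
    supported on a face of the link union.  Since the pole coordinates vanish
    for t = 1/2, and the base coordinates exactly at the two ends, the sum of
    the values need not be 1: they are normalized later. *)
Definition to_suspension (w : A + B -> R) (v : B + bool) : R :=
  match v with
  | inl b => (1 - weightB w) * w (inr b)
  | inr true => pos (2 * weightB w - 1)
  | inr false => pos (1 - 2 * weightB w)
  end.

(** A point of Y need not lie over a point of the simplex on A in a continuous
    way: the vertices a compatible with it are those for which all the
    neighbouring coordinates vanish, a closed condition.  The threshold 1/2
    makes the condition open: a carries weight when its neighbours have small
    total weight, and b carries weight only when its own is large, so that no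
    adjacent a and b do so together.  Adding the top coordinate to all weights
    on B empties the A-side near the top pole, and makes the top pole
    itself go to the barycenter of the simplex on B; the bottom pole goes to
    that of the simplex on A.  Any threshold strictly between 0 and 1 would
    do. *)
Definition from_suspension (y : B + bool -> R) (v : A + B) : R :=
  match v with
  | inl a => pos (2^-1 - y top - \sum_(b | E a b) y (inl b))
  | inr b => pos (y (inl b) + y top - 2^-1)
  end.

Section PointOfX.
Variable x : realization R X.

Lemma weightB_ge0 : 0 <= weightB (coord x).
Proof. by apply: sumr_ge0 => b _; exact: coord_ge0. Qed.

Lemma weightA_weightB :
  \sum_a coord x (inl a) + weightB (coord x) = 1.
Proof. by rewrite -(coord_sum x) big_sumType. Qed.

Lemma weightB_le1 : weightB (coord x) <= 1.
Proof.
rewrite -weightA_weightB lerDr; apply: sumr_ge0 => a _; exact: coord_ge0.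
Qed.

Lemma weightB_lt1_exists :
  weightB (coord x) < 1 -> exists a, 0 < coord x (inl a).
Proof.
move=> t_lt1; apply/not_existsP => x0; move: t_lt1.
rewrite -weightA_weightB big1 ?add0r ?ltxx // => a _.
exact: coord_eq0.
Qed.

Lemma weightB_gt0_exists :
  0 < weightB (coord x) -> exists b, 0 < coord x (inr b).
Proof.
move=> t_gt0; apply/not_existsP => x0; move: t_gt0.
rewrite /weightB big1 ?ltxx // => b _.
exact: coord_eq0.
Qed.

Lemma to_suspension_base_gt0 b : 0 < to_suspension (coord x) (inl b) ->
  weightB (coord x) < 1 /\ 0 < coord x (inr b).
Proof.
rewrite /=; have := weightB_le1; rewrite le_eqVlt => /predU1P[->|t_lt1].
  by rewrite subrr mul0r !ltxx.
by rewrite pmulr_rgt0 ?subr_gt0 // => xb; split.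
Qed.

Lemma to_suspension_cone : cone SY (to_suspension (coord x)).
Proof.
split.
- case=> [b|[]] /=; rewrite ?pos_ge0 // mulr_ge0 ?coord_ge0 //.
  by rewrite subr_ge0 weightB_le1.
- have [t_lt|t_gt|t_eq] := ltgtP (2 * weightB (coord x)) 1.
  + by exists bottom; rewrite /= pos_gt0 subr_gt0.
  + by exists top; rewrite /= pos_gt0 subr_gt0.
  + have [|b xb] := weightB_gt0_exists; first by lra.
    by exists (inl b) => /=; rewrite mulr_gt0 //; lra.
- apply/suspension_face; split; last first.
    by rewrite !inE /= !pos_gt0 => -[]; lra.
  have [/weightB_lt1_exists[a xa]|t_ge1] := ltP (weightB (coord x)) 1.
    exists a => b; rewrite inE => /to_suspension_base_gt0[_ xb].
    by have /X_faces := coord_supp x; apply; rewrite inE.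
  have /card_gt0P[a _] := A_neq0; exists a => b.
  by rewrite inE => /to_suspension_base_gt0[]; rewrite ltNge t_ge1.
Qed.

End PointOfX.

Section PointOfSuspension.
Variable y : realization R SY.

Lemma base_poles_sum :
  \sum_b coord y (inl b) + (coord y top + coord y bottom) = 1.
Proof. by rewrite -(coord_sum y) big_sumType big_bool. Qed.

Lemma poles_exclusive : 0 < coord y top -> 0 < coord y bottom -> False.
Proof. by have /suspension_face[_ +] := coord_supp y; rewrite !inE; tauto. Qed.

Lemma from_suspension_A_gt0 a : 0 < from_suspension (coord y) (inl a) ->
  coord y top < 2^-1 /\ forall b, E a b -> coord y (inl b) + coord y top < 2^-1.
Proof.
rewrite /= pos_gt0 => ya.
have le_sum b : E a b -> coord y (inl b) <= \sum_(b | E a b) coord y (inl b).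
  move=> Eab; rewrite (bigD1 b) //= lerDl; apply: sumr_ge0 => ? _.
  exact: coord_ge0.
have sum_ge0 : 0 <= \sum_(b | E a b) coord y (inl b).
  by apply: sumr_ge0 => ? _; exact: coord_ge0.
by split=> [|b /le_sum]; lra.
Qed.

Lemma from_suspension_cone : cone X (from_suspension (coord y)).
Proof.
split.
- by case=> ? /=; exact: pos_ge0.
- have [n_lt|n_gt|n_eq] := ltgtP (coord y top) 2^-1.
  + have /suspension_face[[a ya] _] := coord_supp y; exists (inl a).
    rewrite /= pos_gt0 big1 ?subr0 ?subr_gt0 // => b Eab.
    by apply: coord_eq0 => yb; have := ya b; rewrite inE Eab => /(_ yb).
  + have /card_gt0P[b _] := B_neq0; exists (inr b) => /=.
    by rewrite pos_gt0; have := coord_ge0 y (inl b); lra.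
  (* At a top coordinate of exactly 1/2 the A-side is empty, and the B-side
     lives on the base support of y, which is inhabited: the bottom coordinate
     is 0, so that half of the mass is in the base. *)
  + have [[b yb]|y0] := pselect (exists b, 0 < coord y (inl b)).
      by exists (inr b); rewrite /= n_eq addrK pos_gt0.
    have y_bottom : coord y bottom = 2^-1.
      have := base_poles_sum; rewrite big1 => [|b _]; first by lra.
      by apply: coord_eq0 => yb; apply: y0; exists b.
    by exfalso; apply: poles_exclusive; rewrite ?y_bottom ?n_eq invr_gt0.
- apply/X_faces => a b; rewrite !inE => /from_suspension_A_gt0[_ ya].
  by rewrite /= pos_gt0; apply: contraTN => /ya; lra.
Qed.

End PointOfSuspension.

Definition suspend : realization R X -> realization R SY :=
  project to_suspension_cone.

Definition desuspend : realization R SY -> realization R X :=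
  project from_suspension_cone.

Lemma continuous_suspend : continuous suspend.
Proof.
have ct : continuous (fun x : realization R X => weightB (coord x)).
  by apply: continuous_sum => b; exact: continuous_coord.
have c2t := continuous_cst_mul (c := 2) ct.
apply: continuous_project => -[b|[]].
- by apply: continuous_mulr; [exact: continuous_cst_sub|exact: continuous_coord].
- exact/continuous_pos/continuous_sub_cst.
- exact/continuous_pos/continuous_cst_sub.
Qed.

Lemma continuous_desuspend : continuous desuspend.
Proof.
apply: continuous_project => -[a|b]; apply: continuous_pos.
- apply: continuous_subr.
    by apply: continuous_cst_sub; exact: continuous_coord.
  by apply: continuous_sum => b; exact: continuous_coord.
- by apply/continuous_sub_cst/continuous_addr; exact: continuous_coord.
Qed.

Lemma suspend_base_gt0 x b :
  0 < coord (suspend x) (inl b) ->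
  weightB (coord x) < 1 /\ 0 < coord x (inr b).
Proof. by rewrite coord_project_gt0; exact: to_suspension_base_gt0. Qed.

Lemma suspend_top_gt0 x :
  (0 < coord (suspend x) top) = (1 < 2 * weightB (coord x)).
Proof. by rewrite coord_project_gt0 /= pos_gt0 subr_gt0. Qed.

Lemma suspend_bottom_gt0 x :
  (0 < coord (suspend x) bottom) = (2 * weightB (coord x) < 1).
Proof. by rewrite coord_project_gt0 /= pos_gt0 subr_gt0. Qed.

Lemma desuspend_A_gt0 y a : 0 < coord (desuspend y) (inl a) ->
  coord y top < 2^-1 /\ forall b, E a b -> coord y (inl b) + coord y top < 2^-1.
Proof. by rewrite coord_project_gt0; exact: from_suspension_A_gt0. Qed.

Lemma desuspend_B_gt0 y b :
  (0 < coord (desuspend y) (inr b)) = (2^-1 < coord y (inl b) + coord y top).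
Proof. by rewrite coord_project_gt0 /= pos_gt0 subr_gt0. Qed.

Lemma suspend_top_eq1 x : weightB (coord x) = 1 -> coord (suspend x) top = 1.
Proof.
move=> t1; have := base_poles_sum (suspend x); rewrite big1 => [|b _].
  have : ~ 0 < coord (suspend x) bottom by rewrite suspend_bottom_gt0 t1; lra.
  by have := coord_ge0 (suspend x) bottom; lra.
by apply: coord_eq0 => /suspend_base_gt0[]; rewrite t1 ltxx.
Qed.

(** The intermediate family m keeps the support inside that of x.  It keeps a
    only while the top coordinate is below the threshold, and b only where the
    desuspended point has b: this is what makes m compatible with that point,
    which x itself is not (near the top pole the desuspended point uses all of
    B, and it may use an a adjacent to some b of small weight in x). *)
Lemma homotopic_desuspend_suspend : homotopic R (desuspend \o suspend) idfun.
Proof.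
pose m (x : realization R X) (v : A + B) : R :=
  let y := coord (suspend x) in
  match v with
  | inl a => coord x (inl a) * pos (2^-1 - y top)
  | inr b => coord x (inr b) * pos (y (inl b) + y top - 2^-1)
  end.
have m_ge0 x v : 0 <= m x v.
  by case: v => v; rewrite mulr_ge0 ?coord_ge0 ?pos_ge0.
have csusp v := continuous_coord_comp (v := v) continuous_suspend.
have m_A x a : 0 < m x (inl a) ->
    0 < coord x (inl a) /\ coord (suspend x) top < 2^-1.
  by rewrite /m mulr_ge0_gt0 ?coord_ge0 ?pos_ge0 // pos_gt0 subr_gt0 => /andP.
have m_B x b : 0 < m x (inr b) -> 0 < coord x (inr b) /\
    2^-1 < coord (suspend x) (inl b) + coord (suspend x) top.
  by rewrite /m mulr_ge0_gt0 ?coord_ge0 ?pos_ge0 // pos_gt0 subr_gt0 => /andP.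
apply: (homotopic_through (m := m)) => //.
- move=> x; apply: continuous_comp; first exact: continuous_suspend.
  exact: continuous_desuspend.
- by move=> x; exact: cvg_id.
- case=> [a|b]; apply: continuous_mulr; try exact: continuous_coord.
    exact/continuous_pos/continuous_cst_sub.
  exact/continuous_pos/continuous_sub_cst/continuous_addr.
- move=> x; have [n_lt|n_ge] := ltP (coord (suspend x) top) 2^-1.
    (* Otherwise t = 1, and the top coordinate would be 1. *)
    have [|a xa] := @weightB_lt1_exists x.
      rewrite lt_neqAle weightB_le1 andbT; apply/eqP => /suspend_top_eq1; lra.
    by exists (inl a); rewrite /m mulr_gt0 // pos_gt0 subr_gt0.
  have n_gt0 : 0 < coord (suspend x) top by lra.
  suff [b xb yb] : exists2 b, 0 < coord x (inr b) &
      2^-1 < coord (suspend x) (inl b) + coord (suspend x) top.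
    by exists (inr b); rewrite /m mulr_gt0 // pos_gt0 subr_gt0.
  have [n_gt|n_le] := ltP 2^-1 (coord (suspend x) top).
    have [|b xb] := @weightB_gt0_exists x.
      by move: n_gt0; rewrite suspend_top_gt0; lra.
    by exists b => //; have := coord_ge0 (suspend x) (inl b); lra.
  have [[b yb]|y0] := pselect (exists b, 0 < coord (suspend x) (inl b)).
    by have [_ xb] := suspend_base_gt0 yb; exists b => //; lra.
  (* The top coordinate is 1/2 and the base is empty, so that the bottom
     coordinate would be 1/2 as well. *)
  exfalso; apply: (poles_exclusive n_gt0).
  have := base_poles_sum (suspend x); rewrite big1 => [|b _]; first by lra.
  by apply: coord_eq0 => yb; apply: y0; exists b.
- move=> x; apply/X_faces => a b; rewrite !inE => aP bP.
  have yb : 2^-1 < coord (suspend x) (inl b) + coord (suspend x) top.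
    by case/orP: bP => [|/m_B[]//]; rewrite desuspend_B_gt0.
  case/orP: aP => [/desuspend_A_gt0[_ ya]|/m_A[xa n_lt]].
    by apply: contraTN yb => /ya; rewrite -leNgt => /ltW.
  have [|_ xb] := @suspend_base_gt0 x b; first by lra.
  by have /X_faces := coord_supp x; apply; rewrite inE.
- move=> x; apply: faces_closed (coord_supp x) _; apply/fintype.subsetP => v.
  by rewrite !inE => /orP[|//]; case: v => v => [/m_A[]|/m_B[]].
Qed.

(** Both the point y and its round trip have their base coordinates supported
    on the support of y, but they may lie in opposite cones: if all base
    coordinates are small, the round trip is the bottom pole, even for y with
    a small positive top coordinate.  The intermediate family m keeps a pole only
    if both of them use it. *)
Lemma homotopic_suspend_desuspend : homotopic R (suspend \o desuspend) idfun.
Proof.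
pose m (y : realization R SY) (v : B + bool) : R :=
  match v with
  | inl b => coord y (inl b)
  | inr i => coord y (inr i) * coord (suspend (desuspend y)) (inr i)
  end.
have m_pole y i : 0 < m y (inr i) ->
    0 < coord y (inr i) /\ 0 < coord (suspend (desuspend y)) (inr i).
  by rewrite /m mulr_ge0_gt0 ?coord_ge0 // => /andP.
have roundtrip : continuous (suspend \o desuspend).
  move=> y; apply: continuous_comp; first exact: continuous_desuspend.
  exact: continuous_suspend.
have base_gt0 y b : 0 < coord (suspend (desuspend y)) (inl b) ->
    0 < coord y (inl b).
  case/suspend_base_gt0 => /weightB_lt1_exists[a /desuspend_A_gt0[n_lt _]].
  by rewrite desuspend_B_gt0; lra.
apply: (homotopic_through (m := m)) => //.
- by move=> y; exact: cvg_id.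
- case=> [b|i]; first exact: continuous_coord.
  apply: continuous_mulr; first exact: continuous_coord.
  exact: continuous_coord_comp.
- move=> y [b|i]; first exact: coord_ge0.
  by apply: mulr_ge0; exact: coord_ge0.
- move=> y; have [[b yb]|y0] := pselect (exists b, 0 < coord y (inl b)).
    by exists (inl b).
  have yE b : coord y (inl b) = 0.
    by apply: coord_eq0 => yb; apply: y0; exists b.
  have [[b|[]] wv] := coord_exists (suspend (desuspend y)).
  + by have := base_gt0 y b wv; rewrite yE ltxx.
  (* With an empty base, y is one of the poles, and it is the pole that the
     round trip reaches. *)
  + exists top; rewrite /m mulr_gt0 //.
    have [|b] := @weightB_gt0_exists (desuspend y).
      by move: wv; rewrite suspend_top_gt0; lra.
    by rewrite desuspend_B_gt0 yE; lra.
  + exists bottom; rewrite /m mulr_gt0 //.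
    have [|a /desuspend_A_gt0[n_lt _]] := @weightB_lt1_exists (desuspend y).
      have := weightB_ge0 (desuspend y).
      by move: wv; rewrite suspend_bottom_gt0; lra.
    by have := base_poles_sum y; rewrite big1 => [|b _]; [lra|exact: yE].
- move=> y; apply/suspension_face; split.
    have /suspension_face[[a ya] _] := coord_supp y; exists a => b sb.
    apply: ya; move: sb; rewrite !inE => /orP[/base_gt0//|].
    exact.
  rewrite !inE => -[topP botP].
  have /poles_exclusive : 0 < coord (suspend (desuspend y)) top.
    by case/orP: topP => // /m_pole[].
  by apply; case/orP: botP => // /m_pole[].
- move=> y; apply: faces_closed (coord_supp y) _; apply/fintype.subsetP => v.
  by rewrite !inE => /orP[|//]; case: v => // i /m_pole[].
Qed.

Lemma homotopy_equivalent_suspension :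
  homotopy_equivalent R (realization R X) (realization R SY).
Proof.
exists suspend, desuspend; split.
- exact: continuous_suspend.
- exact: continuous_desuspend.
- exact: homotopic_desuspend_suspend.
- exact: homotopic_suspend_desuspend.
Qed.

End SuspensionOfLinkUnion.

Theorem proposition2p4 (R : realType) (k : fieldType) (A B : finType)
    (A_neq0 : (0 < #|A|)%N) (B_neq0 : (0 < #|B|)%N)
    (G : rel (A + B)%type) (G_bip : bipartite G)
    (X : complex (A + B)%type)
    (X_SR : stanley_reisner_ideal k X = edge_ideal k G) :
  homotopy_equivalent R (realization R X)
    (realization R (suspension (link_union X))).
Proof.
have [Gsym GA GB] := G_bip.
apply: (@homotopy_equivalent_suspension R A B
  (fun a b => G (inl a) (inr b))) => // s.
split=> [/(face_edge_ideal _ X_SR) sX a b sa sb|sX]; first exact: sX.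
apply/(face_edge_ideal _ X_SR) => -[a|b] [a'|b'] //; first exact: sX.
by rewrite Gsym => ? ?; exact: sX.
Qed.
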